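(* Assume that there exists a storage function $\lambda(x)$ such that strict dissipativity holds for all bounded $x\in\mathcal{X}_h$. Then two-storage strict dissipativity holds for all bounded $x\in\mathcal{X}_h$.
   Context: System and constraints: $x_{k+1}=f(x_k,u_k)$, $x\in\mathbb{R}^{n_x}$, $u\in\mathbb{R}^{n_u}$, stage cost $\ell(x,u)$, constraints $h(x,u)\le 0$, $\mathcal{H}:=\{(x,u): h(x,u)\le 0\}$, $\mathcal{X}_h:=\{x:\exists u,\ h(x,u)\le 0\}$. Standing assumptions of the paper include: $f,\ell,h$ twice continuously differentiable, $f(0,0)=0$, $\ell(0,0)=0$, $\ell$ bounded for bounded $x,u$, and the origin $(0,0)$ is the optimal steady state. Positive definite functions: $\alpha\in\mathcal{PD}$ if $\alpha$ is continuous, nonnegative, $\alpha(0)=0$ and $\alpha(x)>0$ for $x\ne0$. Norm $\|\cdot\|$: any $p$-norm. Dissipativity. Consider, for $(x,u)\in\mathcal{H}$, the inequality (D): $\ell(x,u)+\lambda(x)-\lambda(f(x,u))\ge\rho(\|x\|)$. Storage functions are normalized by $\lambda(0)=0$. On a set $\mathcal{X}$: dissipativity holds if there is a function $\lambda$ (storage function) bounded on $\mathcal{X}$ and continuous at the origin satisfying (D) for all $x\in\mathcal{X}$, $(x,u)\in\mathcal{H}$, with $\rho\equiv0$; strict dissipativity holds if the same is true with some $\rho\in\mathcal{PD}$; two-storage strict dissipativity holds if there are two functions $\lambda_1,\lambda_2$, bounded on $\mathcal{X}$ and continuous at the origin, each satisfying (D) on $\mathcal{X}$ with $\rho\equiv0$,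 and $\gamma\in\mathcal{PD}$ with $\lambda_1(x)\ge\lambda_2(x)+\gamma(\|x\|)$ for all $x\in\mathcal{X}$. ''For all bounded $x\in\mathcal{X}$'' means that the conditions, including boundedness of the storage functions, hold on all bounded subsets of $\mathcal{X}$. *)

(* Defs.v *)
From HB Require Import structures.
From mathcomp Require Import all_boot all_order all_algebra.
From mathcomp Require Import all_classical all_reals all_analysis.

Set Implicit Arguments.
Unset Strict Implicit.
Unset Printing Implicit Defensive.

Import Order.TTheory GRing.Theory Num.Theory.
Import numFieldNormedType.Exports.

Local Open Scope classical_set_scope.
Local Open Scope ring_scope.

(* Vectors of R^n are row vectors 'rV[R]_n, whose library norm is the max norm;
   pnorm is the p-norm for a general exponent, to be used with 1 <= p <= +oo. *)
Definition pnorm (R : realType) (p : \bar R) (n : nat) (x : 'rV[R]_n) : R :=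
  if p is q%:E then (\sum_(i < n) `|x 0 i| `^ q) `^ q^-1
  else \big[Num.max/0]_(i < n) `|x 0 i|.

(* On finite-dimensional spaces, continuity of every directional component of
   the differential is equivalent to its continuity in operator norm. *)
Definition C1 (R : realType) (V W : normedModType R) (g : V -> W) : Prop :=
  (forall z, differentiable g z) /\
  (forall v, continuous (fun z => 'd g z v)).

Definition C2 (R : realType) (V W : normedModType R) (g : V -> W) : Prop :=
  (forall z, differentiable g z) /\
  (forall v, C1 (fun z => 'd g z v)).

(* The functions of class PD are evaluated at norms only: their domain is
   [0, +oo[, and their values at negative reals are irrelevant. *)
Definition PD (R : realType) (alpha : R -> R) : Prop :=
  [/\ {within `[0, +oo[, continuous alpha},
      forall s : R, 0 <= s -> 0 <= alpha s,
      alpha 0 = 0 &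
      forall s : R, 0 <= s -> s != 0 -> 0 < alpha s].

Definition feasible (R : realType) (nx nu nh : nat)
    (h : 'rV[R]_nx * 'rV[R]_nu -> 'rV[R]_nh) : set ('rV[R]_nx * 'rV[R]_nu) :=
  [set z | forall i, h z 0 i <= 0].

Definition feasible_states (R : realType) (nx nu nh : nat)
    (h : 'rV[R]_nx * 'rV[R]_nu -> 'rV[R]_nh) : set 'rV[R]_nx :=
  [set x | exists u, feasible h (x, u)].

Definition optimal_steady_state (R : realType) (nx nu nh : nat)
    (f : 'rV[R]_nx * 'rV[R]_nu -> 'rV[R]_nx)
    (ell : 'rV[R]_nx * 'rV[R]_nu -> R)
    (h : 'rV[R]_nx * 'rV[R]_nu -> 'rV[R]_nh)
    (xs : 'rV[R]_nx) (us : 'rV[R]_nu) : Prop :=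
  [/\ feasible h (xs, us), f (xs, us) = xs &
      forall x u, feasible h (x, u) -> f (x, u) = x ->
        ell (xs, us) <= ell (x, u)].

Definition standing_assumptions (R : realType) (nx nu nh : nat)
    (f : 'rV[R]_nx * 'rV[R]_nu -> 'rV[R]_nx)
    (ell : 'rV[R]_nx * 'rV[R]_nu -> R)
    (h : 'rV[R]_nx * 'rV[R]_nu -> 'rV[R]_nh) : Prop :=
  [/\ [/\ C2 f, C2 (ell : _ -> R^o) & C2 h],
      f (0, 0) = 0,
      ell (0, 0) = 0,
      forall B : set ('rV[R]_nx * 'rV[R]_nu), bounded_set B ->
        [bounded ell z : R^o | z in B] &
      optimal_steady_state f ell h 0 0].

(* lambda is a (normalized) storage function on X: it satisfies the dissipation
   inequality with right-hand side rho (norm x). The successor state f (x, u)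
   need not belong to X. *)
Definition storage_on (R : realType) (p : \bar R) (nx nu nh : nat)
    (f : 'rV[R]_nx * 'rV[R]_nu -> 'rV[R]_nx)
    (ell : 'rV[R]_nx * 'rV[R]_nu -> R)
    (h : 'rV[R]_nx * 'rV[R]_nu -> 'rV[R]_nh)
    (rho : R -> R) (lambda : 'rV[R]_nx -> R) (X : set 'rV[R]_nx) : Prop :=
  [/\ lambda 0 = 0,
      {for 0, continuous lambda},
      [bounded lambda x : R^o | x in X] &
      forall x u, X x -> feasible h (x, u) ->
        ell (x, u) + lambda x - lambda (f (x, u)) >= rho (pnorm p x)].

Definition strictly_dissipative_with (R : realType) (p : \bar R)
    (nx nu nh : nat)
    (f : 'rV[R]_nx * 'rV[R]_nu -> 'rV[R]_nx)
    (ell : 'rV[R]_nx * 'rV[R]_nu -> R)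
    (h : 'rV[R]_nx * 'rV[R]_nu -> 'rV[R]_nh)
    (lambda : 'rV[R]_nx -> R) (rho : R -> R) (X : set 'rV[R]_nx) : Prop :=
  PD rho /\ storage_on p f ell h rho lambda X.

Definition two_storage_strictly_dissipative_with (R : realType) (p : \bar R)
    (nx nu nh : nat)
    (f : 'rV[R]_nx * 'rV[R]_nu -> 'rV[R]_nx)
    (ell : 'rV[R]_nx * 'rV[R]_nu -> R)
    (h : 'rV[R]_nx * 'rV[R]_nu -> 'rV[R]_nh)
    (lambda1 lambda2 : 'rV[R]_nx -> R) (gamma : R -> R)
    (X : set 'rV[R]_nx) : Prop :=
  [/\ PD gamma,
      storage_on p f ell h (fun _ => 0) lambda1 X,
      storage_on p f ell h (fun _ => 0) lambda2 X &
      forall x, X x -> lambda1 x >= lambda2 x + gamma (pnorm p x)].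

(* "C holds for all bounded x in X". The functions occurring in C are fixed
   beforehand, i.e. they do not depend on the bounded subset B. *)
Definition on_bounded_subsets (R : realType) (n : nat) (X : set 'rV[R]_n)
    (C : set 'rV[R]_n -> Prop) : Prop :=
  forall B, B `<=` X -> bounded_set B -> C B.

(* Main.v *)
Require Import Defs.
From mathcomp Require Import all_boot all_order all_algebra.
From mathcomp Require Import all_classical all_reals all_analysis.
From mathcomp Require Import ring.

(** Let lambda be a storage function with strict dissipation rate rho. The whole
    rate can be moved into the storage: lambda1 = lambda and
    lambda2 = lambda - rho (norm _) are two storage functions with zero rate,
    and they differ by exactly gamma = rho. Indeed, writing x' = f (x, u),
    [ell + lambda2 x - lambda2 x'
       = (ell + lambda x - lambda x' - rho (norm x)) + rho (norm x')],
    where the bracket is nonnegative by strict dissipativity and the last term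
    by positivity of rho. In other words, lambda2 charges the dissipated amount
    before the step instead of after it.

    What remains is regularity of lambda2: rho is continuous only on
    [0, +oo[, and only evaluated at p-norms. Since the p-norm is dominated by
    the max norm ([pnorm_le_norm]), rho (norm _) is continuous at the origin
    ([PD_pnorm_continuous0]) and bounded on bounded sets
    ([PD_pnorm_bounded]). *)

Import Order.TTheory GRing.Theory Num.Theory.
Import numFieldNormedType.Exports.

Local Open Scope classical_set_scope.
Local Open Scope ring_scope.

Lemma pnorm_ge0 (R : realType) (p : \bar R) (n : nat) (x : 'rV[R]_n) :
  0 <= pnorm p x.
Proof.
case: p => [q| |] /=; first exact: powR_ge0.
- exact: bigmax_ge_id.
- exact: bigmax_ge_id.
Qed.

Lemma le_coord_norm (R : realType) (n : nat) (x : 'rV[R]_n) (i : 'I_n) :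
  `|x 0 i| <= `|x|.
Proof.
rewrite [leRHS]mx_normrE.
exact: (le_bigmax _ (fun ij => `|x ij.1 ij.2|) (0, i)).
Qed.

(** All coordinates are at most the max norm, so for a finite exponent q the
    best constant is the p-norm of the all-one vector, [n `^ q^-1]. *)
Lemma pnorm_le_norm (R : realType) (p : \bar R) (n : nat) : (1%:E <= p)%E ->
  exists2 C : R, 0 <= C & forall x : 'rV[R]_n, pnorm p x <= C * `|x|.
Proof.
case: p => [q| |] //=; last first.
  move=> _; exists 1 => // x; rewrite mul1r.
  by apply: bigmax_le => // i _; exact: le_coord_norm.
rewrite lee_fin => q1; have q0 : 0 < q by exact: lt_le_trans q1.
exists (n%:R `^ q^-1) => [|x]; first exact: powR_ge0.
have -> : n%:R `^ q^-1 * `|x| = (n%:R * `|x| `^ q) `^ q^-1.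
  by rewrite powRM ?powR_ge0// -powRrM divff ?gt_eqF// powRr1.
apply: ge0_ler_powR; first by rewrite invr_ge0 ltW.
- by rewrite nnegrE; apply: sumr_ge0 => i _; exact: powR_ge0.
- by rewrite nnegrE mulr_ge0 ?powR_ge0.
rewrite mulr_natl -[X in _ *+ X]card_ord -sumr_const.
apply: ler_sum => i _.
by apply: ge0_ler_powR; rewrite ?nnegrE ?(ltW q0)//; exact: le_coord_norm.
Qed.

Lemma pnorm0 (R : realType) (p : \bar R) (n : nat) : (1%:E <= p)%E ->
  pnorm p (0 : 'rV[R]_n) = 0.
Proof.
move=> /(@pnorm_le_norm _ _ n)[C _ /(_ 0)]; rewrite normr0 mulr0 => le0.
by apply/eqP; rewrite eq_le le0 pnorm_ge0.
Qed.

Lemma pnorm_cvg0 (R : realType) (p : \bar R) (n : nat) : (1%:E <= p)%E ->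
  pnorm p x @[x --> (0 : 'rV[R]_n)] --> (0 : R).
Proof.
move=> /(@pnorm_le_norm _ _ n)[C C0 le_C].
apply: (@squeeze_cvgr 'rV[R]_n (nbhs (0 : 'rV[R]_n)) _ R
  (cst 0) (fun x => C * `|x|)).
- by apply: nearW => x; rewrite pnorm_ge0 le_C.
- exact: cvg_cst.
- rewrite -[X in _ --> X](mulr0 C) -[X in C * X](@normr0 _ 'rV[R]_n).
  by apply: cvgMr; exact: norm_continuous.
Qed.

(** rho is continuous at 0 from the right only; this suffices because the
    p-norm tends to 0 through nonnegative values. *)
Lemma PD_pnorm_continuous0 (R : realType) (p : \bar R) (n : nat)
    (rho : R -> R) : (1%:E <= p)%E -> PD rho ->
  {for 0, continuous (fun x : 'rV[R]_n => rho (pnorm p x))}.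
Proof.
move=> p1 [rhoC _ _ _]; rewrite /prop_for /continuous_at pnorm0//.
have rho_cvg0 : rho s @[s --> within `[0, +oo[ (nbhs (0 : R))] --> rho 0.
  by move/subspace_continuousP: rhoC; apply; rewrite /= in_itv/= lexx.
apply: cvg_comp rho_cvg0 => P nearP.
have near0 : \forall x \near (0 : 'rV[R]_n),
    pnorm p x \in `[0, +oo[ -> P (pnorm p x) := pnorm_cvg0 _ _ n p1 _ nearP.
suff : nbhs (0 : 'rV[R]_n) (@pnorm R p n @^-1` P) by [].
by apply: filterS near0 => x; apply; rewrite in_itv/= pnorm_ge0.
Qed.

(** The p-norms of a bounded set lie in a segment [0, c], on which the
    continuous function rho attains a maximum. *)
Lemma PD_pnorm_bounded (R : realType) (p : \bar R) (n : nat)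
    (rho : R -> R) (B : set 'rV[R]_n) : (1%:E <= p)%E -> PD rho ->
  bounded_set B -> exists M, forall x, B x -> rho (pnorm p x) <= M.
Proof.
move=> /(@pnorm_le_norm _ _ n)[C C0 le_C] [rhoC _ _ _].
move=> /ex_strict_bound_gt0[M /ltW M0 BM].
have CM0 : 0 <= C * M by exact: mulr_ge0.
have rhoCM : {within `[0, C * M], continuous rho}.
  apply: continuous_subspaceW rhoC => s /=.
  by rewrite !in_itv/= => /andP[->].
have [c _ maxc] := EVT_max CM0 rhoCM.
exists (rho c) => x /BM /= /ltW xM; apply: maxc.
by rewrite in_itv/= pnorm_ge0 (le_trans (le_C x))// ler_wpM2l.
Qed.

Lemma storage_on_rate0 (R : realType) (p : \bar R) (nx nu nh : nat)
    (f : 'rV[R]_nx * 'rV[R]_nu -> 'rV[R]_nx)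
    (ell : 'rV[R]_nx * 'rV[R]_nu -> R)
    (h : 'rV[R]_nx * 'rV[R]_nu -> 'rV[R]_nh)
    (rho : R -> R) (lambda : 'rV[R]_nx -> R) (B : set 'rV[R]_nx) : PD rho ->
  storage_on p f ell h rho lambda B ->
  storage_on p f ell h (fun=> 0) lambda B.
Proof.
move=> [_ rho_ge0 _ _] [lambda0 lambdaC lambdaB diss]; split=> // x u Bx hxu.
exact: le_trans (rho_ge0 _ (pnorm_ge0 _ _ _ _)) (diss _ _ Bx hxu).
Qed.

(** Subtracting the rate from the storage function uses up the strictness of
    the dissipation inequality and leaves the surplus rho (norm (f (x, u))). *)
Lemma storage_on_sub_rate (R : realType) (p : \bar R) (nx nu nh : nat)
    (f : 'rV[R]_nx * 'rV[R]_nu -> 'rV[R]_nx)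
    (ell : 'rV[R]_nx * 'rV[R]_nu -> R)
    (h : 'rV[R]_nx * 'rV[R]_nu -> 'rV[R]_nh)
    (rho : R -> R) (lambda : 'rV[R]_nx -> R) (B : set 'rV[R]_nx) :
  (1%:E <= p)%E -> PD rho -> bounded_set B ->
  storage_on p f ell h rho lambda B ->
  storage_on p f ell h (fun=> 0) (fun x => lambda x - rho (pnorm p x)) B.
Proof.
move=> p1 PDrho boundedB [lambda0 lambdaC lambdaB diss].
have [_ rho_ge0 rho0 _] := PDrho; split.
- by rewrite pnorm0// rho0 lambda0 subrr.
- exact: (cvgB lambdaC (PD_pnorm_continuous0 _ _ nx _ p1 PDrho)).
- have [M le_M] := PD_pnorm_bounded _ _ _ _ _ p1 PDrho boundedB.
  have [L _ le_L] := ex_strict_bound_gt0 lambdaB.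
  exists (L + M); split; first exact: num_real.
  move=> K /ltW LMK x Bx /=; apply: le_trans LMK.
  apply: le_trans (ler_normB _ _) _; apply: lerD; first exact/ltW/le_L.
  by rewrite ger0_norm ?le_M ?rho_ge0 ?pnorm_ge0.
- move=> x u Bx hxu.
  have -> : ell (x, u) + (lambda x - rho (pnorm p x)) -
      (lambda (f (x, u)) - rho (pnorm p (f (x, u)))) =
      (ell (x, u) + lambda x - lambda (f (x, u)) - rho (pnorm p x)) +
      rho (pnorm p (f (x, u))).
    by ring.
  by rewrite addr_ge0 ?subr_ge0 ?diss ?rho_ge0 ?pnorm_ge0.
Qed.

Theorem theorem3p11 (R : realType) (p : \bar R) (p_ge1 : (1%:E <= p)%E)
    (nx nu nh : nat)
    (f : 'rV[R]_nx * 'rV[R]_nu -> 'rV[R]_nx)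
    (ell : 'rV[R]_nx * 'rV[R]_nu -> R)
    (h : 'rV[R]_nx * 'rV[R]_nu -> 'rV[R]_nh)
    (hyps : standing_assumptions f ell h)
    (hstrict : exists (lambda : 'rV[R]_nx -> R) (rho : R -> R),
       on_bounded_subsets (feasible_states h)
         (strictly_dissipative_with p f ell h lambda rho)) :
  exists (lambda1 lambda2 : 'rV[R]_nx -> R) (gamma : R -> R),
    on_bounded_subsets (feasible_states h)
      (two_storage_strictly_dissipative_with p f ell h lambda1 lambda2 gamma).
Proof.
have [lambda [rho strict]] := hstrict.
exists lambda, (fun x => lambda x - rho (pnorm p x)), rho.
move=> B BX boundedB; have [PDrho sto] := strict B BX boundedB; split=> //.
- exact: storage_on_rate0 sto.
- exact: storage_on_sub_rate sto.
- by move=> x _; rewrite subrK.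
Qed.
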